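(* There do not exist orthogonal quantum Latin squares $\Psi=(\psi_{ij})$ and $\Phi$ of order $6$ such that $\Psi$ is classical with underlying Latin square $L$ (i.e. there are an orthonormal basis $e_1,\dots,e_6$ of $\mathbb C^6$ and a Latin square $L=(L_{ij})$ of order $6$ on $\{1,\dots,6\}$ with $\psi_{ij}\in\mathbb C e_{L_{ij}}$ for all $i,j$) and $L$ has a subsquare of order three, i.e. there are $R,C\subseteq\{1,\dots,6\}$ with $|R|=|C|=3$ such that $\{L_{ij}: i\in R, j\in C\}$ has exactly $3$ elements.
   Context: A quantum Latin square (QLS) of order $n$ is an $n\times n$ matrix $\Psi=(\psi_{ij})_{1\le i,j\le n}$ whose entries are unit vectors in $\mathbb C^n$ such that the entries of each row and the entries of each column form an orthonormal basis of $\mathbb C^n$. Two QLS $\Psi=(\psi_{ij})$ and $\Phi=(\phi_{ij})$ of order $n$ are orthogonal if $\{\psi_{ij}\otimes\phi_{ij}: 1\le i,j\le n\}$ is an orthonormal basis of $\mathbb C^n\otimes\mathbb C^n$. A Latin square of order $n$ is an $n\times n$ array with entries from an $n$-element set in which each symbol occurs exactly once in each row and each column. *)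

(* Defs.v *)
From HB Require Import structures.
From mathcomp Require Import all_boot all_order all_algebra.
From mathcomp Require Import reals complex.
Set Implicit Arguments. Unset Strict Implicit. Unset Printing Implicit Defensive.
Import Order.TTheory GRing.Theory Num.Theory.
Local Open Scope ring_scope.

(* Vectors of C^T are functions T -> C (T a finite index type; C^n = T = 'I_n). *)
Definition hdot (C : numClosedFieldType) (T : finType) (u v : T -> C) : C :=
  \sum_(t : T) (u t)^* * v t.

Definition is_onb (C : numClosedFieldType) (T I : finType) (f : I -> T -> C) : Prop :=
  (forall a b : I, hdot (f a) (f b) = (a == b)%:R) /\
  (forall v : T -> C, exists c : I -> C, forall t : T, v t = \sum_(i : I) c i * f i t).

Definition is_QLS (C : numClosedFieldType) (n : nat)
    (psi : 'I_n -> 'I_n -> 'I_n -> C) : Prop :=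
  (forall i : 'I_n, is_onb (fun j : 'I_n => psi i j)) /\
  (forall j : 'I_n, is_onb (fun i : 'I_n => psi i j)).

(* tensor product u (x) v in C^n (x) C^n = C^('I_n * 'I_n) *)
Definition tensor (C : numClosedFieldType) (S T : finType) (u : S -> C) (v : T -> C)
  : S * T -> C := fun p => u p.1 * v p.2.

Definition orthogonal_QLS (C : numClosedFieldType) (n : nat)
    (psi phi : 'I_n -> 'I_n -> 'I_n -> C) : Prop :=
  is_onb (fun p : 'I_n * 'I_n => tensor (psi p.1 p.2) (phi p.1 p.2)).

Definition is_latin (n : nat) (L : 'I_n -> 'I_n -> 'I_n) : Prop :=
  (forall (i s : 'I_n), #|[set j | L i j == s]| = 1%N) /\
  (forall (j s : 'I_n), #|[set i | L i j == s]| = 1%N).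

Definition classical_with (C : numClosedFieldType) (n : nat)
    (psi : 'I_n -> 'I_n -> 'I_n -> C) (L : 'I_n -> 'I_n -> 'I_n)
    (e : 'I_n -> 'I_n -> C) : Prop :=
  is_onb e /\ forall i j : 'I_n, exists c : C, forall t : 'I_n, psi i j t = c * e (L i j) t.

Definition has_subsquare3 (n : nat) (L : 'I_n -> 'I_n -> 'I_n) : Prop :=
  exists (Rs Cs : {set 'I_n}), #|Rs| = 3%N /\ #|Cs| = 3%N /\
    #|[set L i j | i in Rs, j in Cs]| = 3%N.

(* Main.v *)
Require Import Defs.
From mathcomp Require Import all_boot all_order all_algebra.
From mathcomp Require Import reals complex.
Set Implicit Arguments. Unset Strict Implicit. Unset Printing Implicit Defensive.
Import Order.TTheory GRing.Theory Num.Theory.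
Local Open Scope ring_scope.

(** Put [p i j = |phi_ij><phi_ij|]. Cells in a common row, column or symbol class
    of [L] carry orthogonal projections, and the projections of each such line sum
    to 1. The subsquare splits [L] into four Latin squares of order 3, and counting
    lines shows that the projections of each of these blocks sum to 3/2. A Latin
    square of order 3 is a union of three disjoint transversals; two cells of
    different transversals share a line, so the sum 3/2 forces each transversal to
    be a triple of reflections with sum 0 on its own summand of the space. Hence in
    a block the line reflections [2 (sum of the line) - 1] satisfy
    [(x y)^3 = 1], and all of them anticommute with the commutator [K] of two row
    reflections, where [K^2 = -3].

    Let [r], [c] be reflections of a row and a column of the subsquare, and [t] that
    of a symbol in the block beside it. Complementary parts of a line have opposite
    reflections, so three blocks give [(r c)^3 = 1], [(- r t)^3 = 1] and
    [((- c) (- t))^3 = 1]. As [r t = (r c) (c t)], taking determinants on an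
    eigenspace of [K], which has dimension 3, yields [1 = -1]. *)

(** * Pairs and triples of reflections relative to a local unit [e] *)

Section ReflectionPair.
Variables (A : nzRingType) (e x y : A).
Hypotheses (xx : x * x = e) (yy : y * y = e).
Hypotheses (xe : x * e = x) (ye : y * e = y).
Hypothesis sxy : (x + y) * (x + y) = e.

Lemma refl_pair_swap : y * x = - (e + x * y).
Proof.
move: sxy; rewrite mulrDl !mulrDr xx yy addrA => h.
apply/eqP; rewrite -addr_eq0 addrC; apply/eqP.
by apply: (addIr e); rewrite h add0r.
Qed.

(** For w = x y the inverse relative to [e] is y x, and w + w^-1 = - e. Hence w^2 = - e - w = w^-1,
    which makes w a cube root of [e]. *)
Lemma refl_pair_sqr : x * y * (x * y) = y * x.
Proof.
have : x * y * (y * x) = e by rewrite mulrA -(mulrA x) yy xe xx.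
rewrite {1}refl_pair_swap mulrN mulrDr -(mulrA x y e) ye => h.
by rewrite refl_pair_swap -{1}h opprD opprK addrAC subrr add0r.
Qed.

Lemma refl_pair_cube : (x * y) ^+ 3 = e.
Proof. by rewrite exprS expr2 refl_pair_sqr mulrA -(mulrA x) yy xe xx. Qed.

Lemma refl_pair_anticommutator : x * y + y * x = - e.
Proof. by rewrite refl_pair_swap opprD addrCA subrr addr0. Qed.

End ReflectionPair.

Section ReflectionTriple.
Variables (A : nzRingType) (e : A) (a : 'I_3 -> A).
Hypotheses (aa : forall k, a k * a k = e).
Hypotheses (ae : forall k, a k * e = a k) (ea : forall k, e * a k = a k).
Hypothesis a_sum0 : \sum_k a k = 0.

Let ee : e * e = e. Proof. by rewrite -{2}(aa 0) mulrA ea aa. Qed.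

Let third k l m : k != l -> k != m -> l != m -> a m = - (a k + a l).
Proof.
move=> kl km lm; apply/eqP; rewrite -addr_eq0 addrC; apply/eqP.
rewrite -[RHS]a_sum0 (bigD1 k) //= (bigD1 l) 1?eq_sym //=.
rewrite (bigD1 m) /=; last by rewrite ![m == _]eq_sym km.
rewrite big_pred0 ?addr0 ?addrA // => j.
by case: k l m j kl km lm => [[|[|[|//]]] ?] [[|[|[|//]]] ?] [[|[|[|//]]] ?]
  [[|[|[|//]]] ?].
Qed.

Let pair_sum_sqr k l : k != l -> (a k + a l) * (a k + a l) = e.
Proof.
move=> kl; have [m /andP[km lm]] : exists m, (k != m) && (l != m).
  (* The three elements of Z/3 sum to 0, which determines the third index. *)
  by exists (- (k + l)); case: k l kl => [[|[|[|//]]] ?] [[|[|[|//]]] ?].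
by rewrite -[LHS]mulrNN -(third kl km lm) aa.
Qed.

Lemma refl_triple_cube k l : (a k * a l) ^+ 3 = e.
Proof.
have [->|kl] := eqVneq k l; first by rewrite aa !exprS expr0 mulr1 !ee.
have kl2 := pair_sum_sqr kl.
exact: refl_pair_cube.
Qed.

(** For w = a_k a_l, (w - w^-1)^2 = w^2 + w^-2 - 2e, and w^2 = w^-1 turns this into w^-1 + w - 2e =
    - 3e. *)
Lemma refl_triple_commutator_sqr k l :
  k != l -> (a k * a l - a l * a k) ^+ 2 = - (e *+ 3).
Proof.
move=> kl; have kl2 := pair_sum_sqr kl.
have lk2 : (a l + a k) * (a l + a k) = e by rewrite addrC.
rewrite expr2 mulrBl !mulrBr (refl_pair_sqr _ _ _ _ kl2) //.
rewrite (refl_pair_sqr _ _ _ _ lk2) //.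
rewrite [a k * _ * _]mulrA -(mulrA (a k)) aa ae aa.
rewrite [a l * _ * _]mulrA -(mulrA (a l)) aa ae aa.
rewrite opprB addrACA addrC [a l * _ + _]addrC.
by rewrite (refl_pair_anticommutator _ _ kl2) // -!opprD !mulrS mulr0n addr0 addrC.
Qed.

(** A reflection anticommutes with its commutator with any other one: a_k (a_k a_l - a_l a_k) = a_l
    - a_k a_l a_k. Linearity covers the third one, which is - (a_k + a_l). *)
Lemma refl_triple_anticomm k l m :
  a m * (a k * a l - a l * a k) = - ((a k * a l - a l * a k) * a m).
Proof.
have hk i j : a i * (a i * a j - a j * a i) = - ((a i * a j - a j * a i) * a i).
  by rewrite mulrBr mulrBl !mulrA aa opprB -(mulrA (a j)) aa ea ae.
have hl i j : a j * (a i * a j - a j * a i) = - ((a i * a j - a j * a i) * a j).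
  by rewrite -(opprB (a j * a i)) mulrN mulNr hk.
have [<-|mk] := eqVneq m k; first exact: hk.
have [<-|ml] := eqVneq m l; first exact: hl.
have [->|kl] := eqVneq k l; first by rewrite subrr mulr0 mul0r oppr0.
rewrite (@third k l m kl) 1?eq_sym //.
move: (hk k l) (hl k l); move: (_ - _) => K hkK hlK.
by rewrite mulNr mulrN mulrDl mulrDr hkK hlK -opprD.
Qed.

End ReflectionTriple.

(** * Orthogonal summands and the line reflections of a block *)

Section DirectSum.
Variables (A : nzRingType) (I : finType) (e : I -> A).
Hypothesis e_orth : forall c d, c != d -> e c * e d = 0.

Lemma mulr_sum_orth (x y : I -> A) :
  (forall c, x c * e c = x c) -> (forall c, e c * y c = y c) ->
  (\sum_c x c) * (\sum_c y c) = \sum_c x c * y c.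
Proof.
move=> xe ey; rewrite mulr_suml; apply: eq_bigr => c _.
rewrite mulr_sumr (bigD1 c) //= big1 ?addr0 // => d dc.
by rewrite -xe -ey mulrA -(mulrA (x c)) e_orth 1?eq_sym // mulr0 mul0r.
Qed.

End DirectSum.

Definition refl_of (A : nzRingType) (x : A) : A := x *+ 2 - 1.

Lemma refl_of_compl (A : nzRingType) (x y : A) :
  x + y = 1 -> refl_of y = - refl_of x.
Proof.
move=> xy; apply/eqP; rewrite -addr_eq0 /refl_of addrACA -mulrnDl addrC.
rewrite [y + x]addrC xy.
by rewrite -opprD addrC subrr.
Qed.

(* The cells of a 3x3 Latin square split into three transversals. Below [q c k]
   is the projection at the k-th cell of transversal c; every line (row, column
   or symbol) meets each transversal once, so it is a map [f] from transversals
   to positions. *)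
Definition line_refl (A : nzRingType) (q : 'I_3 -> 'I_3 -> A)
  (f : 'I_3 -> 'I_3) : A := refl_of (\sum_c q c (f c)).

Section Block.
Variables (F : numFieldType) (A : algType F) (q : 'I_3 -> 'I_3 -> A).
Hypothesis q_idem : forall c k, q c k * q c k = q c k.
Hypothesis q_orth : forall c d k l, c != d -> q c k * q d l = 0.
Hypothesis q_total : (\sum_c \sum_k q c k) *+ 2 = 3%:R.

(** By [q_total] the factor 2/3 makes the [e c] sum to 1, so [e c] can serve as the unit of the
    summand of transversal c. The same factor gives \sum_k a c k = 2 S - 3 (2/3) S = 0, where S =
    \sum_k q c k. *)
Let e c : A := (2%:R / 3%:R) *: \sum_k q c k.
Let a c k : A := q c k *+ 2 - e c.

Let sum_e : \sum_c e c = 1.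
Proof.
rewrite -scaler_sumr mulrC -scalerA scaler_nat q_total -(scaler_nat 3 1).
by rewrite scalerA mulVf ?scale1r // pnatr_eq0.
Qed.

(** Multiplying [sum_e] by [q c k] kills the terms of the other transversals. Summing over k then
    makes [e c] idempotent, although cells of one transversal need not be orthogonal. *)
Let qe c k : q c k * e c = q c k.
Proof.
rewrite -[RHS]mulr1 -sum_e mulr_sumr (bigD1 c) //= big1 ?addr0 // => d dc.
by rewrite -scalerAr mulr_sumr big1 ?scaler0 // => l _; rewrite q_orth 1?eq_sym.
Qed.

Let e_q c k : e c * q c k = q c k.
Proof.
rewrite -[RHS]mul1r -sum_e mulr_suml (bigD1 c) //= big1 ?addr0 // => d dc.
by rewrite -scalerAl mulr_suml big1 ?scaler0 // => l _; rewrite q_orth.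
Qed.

Let ee c : e c * e c = e c.
Proof.
rewrite {1 3}/e -scalerAl mulr_suml.
by congr (_ *: _); apply: eq_bigr => k _; rewrite qe.
Qed.

Let e_orth c d : c != d -> e c * e d = 0.
Proof.
move=> cd; rewrite -scalerAl -scalerAr mulr_suml big1 ?scaler0 // => k _.
by rewrite mulr_sumr big1 // => l _; rewrite q_orth.
Qed.

Let ae c k : a c k * e c = a c k.
Proof. by rewrite mulrBl mulrnAl qe ee. Qed.

Let ea c k : e c * a c k = a c k.
Proof. by rewrite mulrBr mulrnAr e_q ee. Qed.

Let aa c k : a c k * a c k = e c.
Proof.
rewrite {1}/a mulrBl ea mulrnAl {1}/a mulrBr mulrnAr q_idem qe.
by rewrite mulr2n addrK -mulr2n opprB addrCA subrr addr0.
Qed.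

Let sum_a c : \sum_k a c k = 0.
Proof.
rewrite sumrB sumr_const card_ord sumrMnl /e.
rewrite -!scaler_nat scalerA -scalerBl mulrC divfK ?subrr ?scale0r //.
by rewrite pnatr_eq0.
Qed.

Let line_reflE f : line_refl q f = \sum_c a c (f c).
Proof. by rewrite /line_refl /refl_of /a sumrB sum_e sumrMnl. Qed.

Lemma line_refl_sqr f : line_refl q f * line_refl q f = 1.
Proof.
rewrite !line_reflE (mulr_sum_orth e_orth) // -sum_e.
by apply: eq_bigr => c _; rewrite aa.
Qed.

Let mul_refl f g : line_refl q f * line_refl q g = \sum_c a c (f c) * a c (g c).
Proof. by rewrite !line_reflE (mulr_sum_orth e_orth). Qed.

Lemma line_refl_cube f g : (line_refl q f * line_refl q g) ^+ 3 = 1.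
Proof.
have ma c k l : a c k * a c l * e c = a c k * a c l by rewrite -mulrA ae.
have am c k l : e c * (a c k * a c l) = a c k * a c l by rewrite mulrA ea.
rewrite mul_refl exprS expr2 (mulr_sum_orth e_orth) //.
rewrite (mulr_sum_orth e_orth) => [|//|c]; last by rewrite mulrA am.
rewrite -sum_e; apply: eq_bigr => c _; rewrite -expr2 -exprS.
exact: (@refl_triple_cube _ (e c) (a c)).
Qed.

Let commutatorE f g :
  line_refl q f * line_refl q g - line_refl q g * line_refl q f =
  \sum_c (a c (f c) * a c (g c) - a c (g c) * a c (f c)).
Proof. by rewrite !mul_refl sumrB. Qed.

Let ke c k l :
  (a c k * a c l - a c l * a c k) * e c = a c k * a c l - a c l * a c k.
Proof. by rewrite mulrBl -!mulrA !ae. Qed.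

Let ek c k l :
  e c * (a c k * a c l - a c l * a c k) = a c k * a c l - a c l * a c k.
Proof. by rewrite mulrBr !mulrA !ea. Qed.

Lemma line_refl_anticomm f g h :
  let K := line_refl q f * line_refl q g - line_refl q g * line_refl q f in
  line_refl q h * K = - (K * line_refl q h).
Proof.
rewrite /= commutatorE line_reflE !(mulr_sum_orth e_orth) // -sumrN.
apply: eq_bigr => c _; exact: (@refl_triple_anticomm _ (e c) (a c)).
Qed.

Lemma line_refl_commutator_sqr f g : (forall c, f c != g c) ->
  (line_refl q f * line_refl q g - line_refl q g * line_refl q f) ^+ 2 = - 3%:R.
Proof.
move=> fg; rewrite commutatorE expr2 (mulr_sum_orth e_orth) //.
rewrite -sum_e -sumrMnl -sumrN; apply: eq_bigr => c _.
rewrite -expr2; exact: (@refl_triple_commutator_sqr _ (e c) (a c)).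
Qed.

End Block.

(** * Determinants on an eigenspace of odd dimension *)

Section OddEigenspace.
Variables (F : numClosedFieldType) (n m : nat).
Hypotheses (n_eq : n.+1 = m.*2) (m_odd : odd m).
Variables K r : 'M[F]_n.+1.
Hypotheses (K_sqr : K ^+ 2 = - 3%:R) (rr : r * r = 1) (rK : r * K = - (K * r)).

(* [E] projects, up to a scalar, onto an eigenspace of [K]; since [r]
   exchanges the two eigenspaces, its rank is m. *)
Let z : F := sqrtC (- 3%:R).
Let E : 'M[F]_n.+1 := K + z%:M.

Let rank_E : \rank E = m.
Proof.
pose E' : 'M[F]_n.+1 := K - z%:M.
have zz : z ^+ 2 = - 3%:R by exact: sqrtCK.
have r_unit : r \in unitmx by case/mulmx1_unit: rr.
have rankE' : \rank E' = \rank E.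
  rewrite -(mxrankMfree E (B := r)) ?row_free_unit // -[RHS]mxrank_opp.
  have -> : - (E *m r) = r *m E'.
    rewrite mulmxDl mulmxBr -[r *m K]/(r * K) rK opprD.
    by rewrite scalar_mxC.
  by rewrite eqmxMfull // row_full_unit.
have EE' : E *m E' = 0.
  rewrite mulmxDl !mulmxBr -[K *m K]/(K * K) -expr2 K_sqr.
  rewrite scalar_mxC addrA subrK -scalar_mxM -expr2 zz.
  by rewrite raddfN /= opprK rmorph_nat addNr.
have z_neq0 : z != 0 by rewrite sqrtC_eq0 oppr_eq0 pnatr_eq0.
(* E - E' = 2z is invertible, which bounds the sum of the two equal ranks from below; E E' = 0
   bounds it from above. *)
have lo : (n.+1 <= \rank E + \rank E')%N.
  rewrite -(mxrank_opp E'); apply: leq_trans (mxrank_add _ _).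
  rewrite opprB addrCA /E [K + _]addrC addrK mxrank_unit //.
  rewrite -raddfD /= unitmxE det_scalar unitfE expf_neq0 //.
  by rewrite -mulr2n mulrn_eq0.
have := mulmx0_rank_max EE'; rewrite rankE' addnn => hi.
move: lo; rewrite rankE' addnn => lo.
have /eqP : (\rank E).*2 == m.*2 by rewrite -n_eq eqn_leq hi lo.
exact: double_inj.
Qed.

Let B := row_base E.
(** Matrix, in the basis [B], of the right action of [M] on the row space of [E], the eigenspace of
    [K] for z. This space is stable when [M] commutes with [K], since then E M = M E. *)
Let restr (M : 'M[F]_n.+1) := B *m M *m pinvmx B.

Let restrM M N : M * K = K * M -> restr (M * N) = restr M *m restr N.
Proof.
move=> MK; rewrite /restr [RHS]mulmxA [B *m M *m _ *m (_ *m _)]mulmxA mulmxKpV.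
  by congr (_ *m _); rewrite -[RHS]mulmxA.
rewrite (eqmxMr _ (eq_row_base E)) eq_row_base.
have -> : E *m M = M *m E.
  by rewrite mulmxDl mulmxDr scalar_mxC -[K *m M]/(K * M) -MK.
exact: submxMl.
Qed.

Lemma no_odd_cube_roots M N :
  M * K = K * M -> N * K = K * N -> M ^+ 3 = 1 -> N ^+ 3 = 1 ->
  (M * N) ^+ 3 != - 1.
Proof.
move=> MK NK M3 N3; apply/eqP => MN3.
have restr1 : restr 1 = 1%:M by rewrite /restr mulmx1 mulmxVp // row_base_free.
have det3 X : X * K = K * X -> \det (restr X) ^+ 3 = \det (restr (X ^+ 3)).
  move=> XK; rewrite exprS expr2 [in RHS]exprS [in RHS]expr2.
  by rewrite !restrM // !det_mulmx.
have detM : \det (restr M) ^+ 3 = 1 by rewrite det3 // M3 restr1 det1.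
have detN : \det (restr N) ^+ 3 = 1 by rewrite det3 // N3 restr1 det1.
have MNK : M * N * K = K * (M * N) by rewrite -mulrA NK !mulrA MK.
have := det3 _ MNK; rewrite restrM // det_mulmx exprMn detM detN mulr1 MN3.
have -> : restr (-1) = (- 1)%:M by rewrite raddfN /= -restr1 /restr mulmxN mulNmx.
rewrite det_scalar rank_E -signr_odd m_odd expr1 => /eqP.
by rewrite -subr_eq0 opprK -mulr2n pnatr_eq0.
Qed.

End OddEigenspace.

(** * Latin squares of order three *)

Lemma ord3_ind (P : 'I_3 -> Prop) : P 0 -> P 1 -> P (-1) -> forall a, P a.
Proof.
move=> P0 P1 P2 [[|[|[|//]]] h].
- by rewrite (_ : Ordinal h = 0) //; apply/val_inj.
- by rewrite (_ : Ordinal h = 1) //; apply/val_inj.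
- by rewrite (_ : Ordinal h = -1) //; apply/val_inj.
Qed.

(** Rows 1 and -1 have no fixed point and differ everywhere, so they are the two 3-cycles, in one
    order or the other. *)
Lemma latin3_cyclic (g : 'I_3 -> 'I_3 -> 'I_3) :
  (forall b, g 0 b = b) -> (forall a, injective (g a)) ->
  (forall b, injective (g^~ b)) ->
  (forall a b, g a b = a + b) \/ (forall a b, g a b = - a + b).
Proof.
move=> g0 grow gcol.
have row a b c : b != c -> g a b != g a c by apply: contra_neq; apply: grow.
have col a b c : a != c -> g a b != g c b by apply: contra_neq; apply: gcol.
have [o0 o1 o2] : [/\ (0 : 'I_3) != 1, (0 : 'I_3) != -1 & (1 : 'I_3) != -1] by [].
have cases (x : 'I_3) : [\/ x = 0, x = 1 | x = -1].
  by elim/ord3_ind: x; [apply: Or31 | apply: Or32 | apply: Or33].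
move: (row 1 _ _ o0) (row 1 _ _ o1) (row 1 _ _ o2).
move: (row (-1) _ _ o0) (row (-1) _ _ o1) (row (-1) _ _ o2).
move: (col _ 0 _ o0) (col _ 0 _ o1) (col _ 0 _ o2).
move: (col _ 1 _ o0) (col _ 1 _ o1) (col _ 1 _ o2).
move: (col _ (-1) _ o0) (col _ (-1) _ o1) (col _ (-1) _ o2).
rewrite !g0.
case: (cases (g 1 0)) => e1; rewrite e1 //.
all: case: (cases (g 1 1)) => e2; rewrite e2 //.
all: case: (cases (g 1 (-1))) => e3; rewrite e3 //.
all: case: (cases (g (-1) 0)) => e4; rewrite e4 //.
all: case: (cases (g (-1) 1)) => e5; rewrite e5 //.
all: case: (cases (g (-1) (-1))) => e6; rewrite e6 //.
all: move=> *.
all: (left; do 2!elim/ord3_ind; rewrite ?g0 ?e1 ?e2 ?e3 ?e4 ?e5 ?e6;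
      by apply/val_inj) ||
     (right; do 2!elim/ord3_ind; rewrite ?g0 ?e1 ?e2 ?e3 ?e4 ?e5 ?e6;
      by apply/val_inj).
Qed.

Lemma enum_card3 (T : finType) (X : {set T}) : #|X| = 3 ->
  exists2 f : 'I_3 -> T, injective f & X = [set f k | k in 'I_3].
Proof.
move=> X3; pose f (k : 'I_3) : T := enum_val (cast_ord (esym X3) k).
have f_inj : injective f by move=> k l /enum_val_inj/cast_ord_inj.
exists f => //; apply/esym/eqP.
rewrite eqEcard card_imset // X3 card_ord leqnn andbT.
by apply/subsetP => _ /imsetP[k _ ->]; apply: enum_valP.
Qed.

Lemma latin3_normal_form (I J S : finType) (L : I -> J -> S)
    (R : {set I}) (C : {set J}) (T : {set S}) :
  #|R| = 3 -> #|C| = 3 -> #|T| = 3 ->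
  (forall i, injective (L i)) -> (forall j, injective (L^~ j)) ->
  (forall i j, i \in R -> j \in C -> L i j \in T) ->
  exists fi fj fs, [/\ [/\ injective fi, injective fj & injective fs],
    R = [set fi a | a in 'I_3], C = [set fj b | b in 'I_3],
    T = [set fs d | d in 'I_3] & forall a b, L (fi a) (fj b) = fs (a + b)].
Proof.
move=> R3 C3 T3 Lrow Lcol LT.
have [fi fi_inj RE] := enum_card3 R3; have [fj fj_inj CE] := enum_card3 C3.
have fiR a : fi a \in R by rewrite RE imset_f.
have fjC b : fj b \in C by rewrite CE imset_f.
(* Naming the symbols by the first row puts the square in the form required by [latin3_cyclic]. *)
pose fs d := L (fi 0) (fj d).
have fs_inj : injective fs by move=> k l /Lrow/fj_inj.
have TE : T = [set fs d | d in 'I_3].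
  apply/esym/eqP; rewrite eqEcard card_imset // T3 card_ord leqnn andbT.
  by apply/subsetP => _ /imsetP[d _ ->]; apply: LT.
have gP a b : exists d, L (fi a) (fj b) == fs d.
  have := LT _ _ (fiR a) (fjC b); rewrite TE => /imsetP[d _ ->].
  by exists d.
pose g a b := xchoose (gP a b).
have gE a b : L (fi a) (fj b) = fs (g a b) by apply/eqP/(xchooseP (gP a b)).
have [|||h|h] := @latin3_cyclic g.
- by move=> b; apply: fs_inj; rewrite -gE.
- by move=> a b c eg; apply/fj_inj/(Lrow (fi a)); rewrite !gE eg.
- by move=> b a c eg; apply/fi_inj/(Lcol (fj b)); rewrite !gE eg.
- by exists fi, fj, fs; split=> // a b; rewrite gE h.
(* Relabelling the rows by negation turns - a + b into a + b. *)
- exists (fi \o -%R), fj, fs; split=> //=.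
  + by split=> //; apply: inj_comp fi_inj oppr_inj.
  + apply/setP=> i; rewrite RE; apply/imsetP/imsetP => -[a _ ->].
      by exists (- a); rewrite //= opprK.
    by exists (- a).
  + by move=> a b; rewrite gE h opprK.
Qed.

(** * Transversals and reflections of a Latin block of projections *)

Section LatinBlock.
Variables (A : nzRingType) (I J S : finType) (L : I -> J -> S) (p : I -> J -> A).
Hypotheses (L_row : forall i, injective (L i)) (L_col : forall j, injective (L^~ j)).
Hypothesis p_idem : forall i j, p i j * p i j = p i j.
Hypothesis p_row : forall i j j', j != j' -> p i j * p i j' = 0.
Hypothesis p_col : forall i i' j, i != i' -> p i j * p i' j = 0.
Hypothesis p_sym : forall i i' j j',
  i != i' -> L i j = L i' j' -> p i j * p i' j' = 0.

Definition row_sum (C : {set J}) i : A := \sum_(j in C) p i j.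
Definition col_sum (R : {set I}) j : A := \sum_(i in R) p i j.
Definition sym_sum (R : {set I}) (C : {set J}) s : A :=
  \sum_(i in R) \sum_(j in C | L i j == s) p i j.

Lemma latin_block_transversals (R : {set I}) (C : {set J}) (T : {set S}) :
  #|R| = 3 -> #|C| = 3 -> #|T| = 3 ->
  (forall i j, i \in R -> j \in C -> L i j \in T) ->
  exists q : 'I_3 -> 'I_3 -> A,
  [/\ (forall c k, q c k * q c k = q c k) /\
      (forall c d k l, c != d -> q c k * q d l = 0),
      \sum_c \sum_k q c k = \sum_(i in R) row_sum C i,
      forall i i', i \in R -> i' \in R -> i != i' ->
        exists f g, [/\ forall c, f c != g c,
          row_sum C i = \sum_c q c (f c) & row_sum C i' = \sum_c q c (g c)],
      forall j, j \in C -> exists f, col_sum R j = \sum_c q c (f c) &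
      forall s, s \in T -> exists f, sym_sum R C s = \sum_c q c (f c)].
Proof.
move=> R3 C3 T3 LT.
have [fi [fj [fs [[fi_inj fj_inj fs_inj] -> -> -> LE]]]] :=
  latin3_normal_form R3 C3 T3 L_row L_col LT.
(* Transversal c is the broken diagonal b = a - c, indexed by its row k; its symbol there is 2k - c
   = - (k + c). So row a meets it at k = a, column b at k = b + c and symbol d at k = - (c + d). *)
pose q c k := p (fi k) (fj (k - c)).
have rowE a : row_sum [set fj b | b in 'I_3] (fi a) = \sum_c q c a.
  rewrite /row_sum big_imset /=; last by move=> ? ? _ _ /fj_inj.
  by rewrite (reindex_inj (@subrI _ a)).
exists q; split.
- split=> [c k|c d k l cd]; first exact: p_idem.
  rewrite /q; have [->|kl] := eqVneq k l.
    by apply: p_row; apply: contra_neq cd => /fj_inj/subrI.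
  have [->|kcld] := eqVneq (k - c) (l - d).
    by apply: p_col; apply: contra_neq kl => /fi_inj.
  (* Here x = k - l and y = c - d are nonzero and distinct in Z/3, so y = - x and the symbols differ
     by 2x - y = 3x = 0. *)
  apply: p_sym; first by apply: contra_neq kl => /fi_inj.
  rewrite !LE; congr fs; move: c d k l cd kl kcld.
  by do 4!elim/ord3_ind; move=> //= *; apply/val_inj.
- rewrite big_imset /=; last by move=> ? ? _ _ /fi_inj.
  by rewrite exchange_big; apply: eq_bigr => a _; rewrite rowE.
- move=> _ _ /imsetP[a _ ->] /imsetP[b _ ->] ab.
  exists (fun=> a), (fun=> b); rewrite !rowE; split=> // _.
  by apply: contra_neq ab => ->.
- move=> _ /imsetP[b _ ->]; exists (fun c => b + c).
  rewrite /col_sum big_imset /=; last by move=> ? ? _ _ /fi_inj.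
  rewrite (reindex_inj (@addrI _ b)) /=.
  by apply: eq_bigr => c _; rewrite /q addrK.
- move=> _ /imsetP[d _ ->]; exists (fun c => - (c + d)).
  rewrite /sym_sum big_imset /=; last by move=> ? ? _ _ /fi_inj.
  rewrite (reindex_inj (inj_comp oppr_inj (@addIr _ d))) /=.
  apply: eq_bigr => c _; rewrite /q.
  rewrite (big_pred1 (fj (- (c + d) - c))) // => j /=.
  apply/andP/eqP => [[/imsetP[b _ ->]]|->].
    rewrite LE (inj_eq fs_inj) => bd; congr fj; move: b c d bd.
    by do 3!elim/ord3_ind; move=> //= _; apply/val_inj.
  rewrite imset_f // LE; split=> //; apply/eqP; congr fs.
  by move: c d; do 2!elim/ord3_ind; apply/val_inj.
Qed.
End LatinBlock.

Section BlockRelations.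
Variables (F : numFieldType) (A : algType F) (I J S : finType).
Variables (L : I -> J -> S) (p : I -> J -> A).
Hypotheses (L_row : forall i, injective (L i)) (L_col : forall j, injective (L^~ j)).
Hypothesis p_idem : forall i j, p i j * p i j = p i j.
Hypothesis p_row : forall i j j', j != j' -> p i j * p i j' = 0.
Hypothesis p_col : forall i i' j, i != i' -> p i j * p i' j = 0.
Hypothesis p_sym : forall i i' j j',
  i != i' -> L i j = L i' j' -> p i j * p i' j' = 0.

(** Distinct rows meet each transversal in different cells, so K^2 takes the value -3 on every
    summand. *)
Lemma latin_block_relations (R : {set I}) (C : {set J}) (T : {set S}) i i' j s :
  #|R| = 3 -> #|C| = 3 -> #|T| = 3 ->
  (forall i j, i \in R -> j \in C -> L i j \in T) ->
  (\sum_(i in R) row_sum p C i) *+ 2 = 3%:R ->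
  i \in R -> i' \in R -> i != i' -> j \in C -> s \in T ->
  let r := refl_of (row_sum p C i) in
  let r' := refl_of (row_sum p C i') in
  let c := refl_of (col_sum p R j) in
  let t := refl_of (sym_sum L p R C s) in
  let K := r * r' - r' * r in
  [/\ K ^+ 2 = - 3%:R,
      [/\ r * r = 1 & c * c = 1],
      [/\ r * K = - (K * r), c * K = - (K * c) & t * K = - (K * t)] &
      [/\ (r * c) ^+ 3 = 1, (r * t) ^+ 3 = 1 & (c * t) ^+ 3 = 1]].
Proof.
move=> R3 C3 T3 LT tot iR i'R ii' jC sT.
have [q [[q_idem q_orth] totE rowE colE symE]] :=
  latin_block_transversals L_row L_col p_idem p_row p_col p_sym R3 C3 T3 LT.
have [f [f' [ff' -> ->]]] := rowE _ _ iR i'R ii'.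
have [g ->] := colE _ jC; have [h ->] := symE _ sT.
rewrite -!/(line_refl q _); rewrite -totE in tot.
split; first exact: line_refl_commutator_sqr.
- by split; apply: line_refl_sqr.
- by split; apply: line_refl_anticomm.
- by split; apply: line_refl_cube.
Qed.

End BlockRelations.

(** * The four blocks of a projection square of order six *)

Lemma mem_inj_card_eq (I S : finType) (f : I -> S) (C : {set I}) (T : {set S}) :
  injective f -> (forall j, j \in C -> f j \in T) -> #|C| = #|T| ->
  forall j, (f j \in T) = (j \in C).
Proof.
move=> f_inj fT CT j; suff -> : T = f @: C by rewrite mem_imset.
apply/esym/eqP; rewrite eqEcard card_imset // CT leqnn andbT.
by apply/subsetP => _ /imsetP[k kC ->]; apply: fT.
Qed.

Section ProjectionSquare.
Variables (F : numClosedFieldType) (L : 'I_6 -> 'I_6 -> 'I_6).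
Variable p : 'I_6 -> 'I_6 -> 'M[F]_6.
Hypotheses (L_row : forall i, injective (L i)) (L_col : forall j, injective (L^~ j)).
Hypothesis p_idem : forall i j, p i j * p i j = p i j.
Hypothesis p_row : forall i j j', j != j' -> p i j * p i j' = 0.
Hypothesis p_col : forall i i' j, i != i' -> p i j * p i' j = 0.
Hypothesis p_sym : forall i i' j j',
  i != i' -> L i j = L i' j' -> p i j * p i' j' = 0.
Hypothesis sum_row : forall i, \sum_j p i j = 1.
Hypothesis sum_col : forall j, \sum_i p i j = 1.
Hypothesis sum_sym : forall s, \sum_i \sum_(j | L i j == s) p i j = 1.

Lemma no_projection_square : ~ has_subsquare3 L.
Proof.
move=> [R [C [R3 [C3 S3]]]].
set S : {set 'I_6} := [set L i j | i in R, j in C] in S3.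
have compl3 (X : {set 'I_6}) : #|X| = 3 -> #|~: X| = 3.
  by move=> X3; apply: (@addnI 3); rewrite -{1}X3 cardsC card_ord.
have R'3 := compl3 _ R3; have C'3 := compl3 _ C3; have S'3 := compl3 _ S3.
have LA i j : i \in R -> j \in C -> L i j \in S by move=> *; apply: imset2_f.
have LR i j : i \in R -> (L i j \in S) = (j \in C).
  move=> iR; apply: mem_inj_card_eq => //; last by rewrite C3.
  by move=> k; apply: LA.
have LC i j : j \in C -> (L i j \in S) = (i \in R).
  move=> jC; apply: (@mem_inj_card_eq _ _ (L^~ j)) => //; last by rewrite R3.
  by move=> k kR; apply: LA.
(* Outside [R] the columns of [C] avoid [S], so they carry exactly the three symbols of [~: S]. *)
have LR' i j : i \notin R -> (L i j \in S) = (j \notin C).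
  move=> iR; apply: negb_inj; rewrite negbK -in_setC.
  apply: mem_inj_card_eq => //; last by rewrite C3.
  by move=> k kC; rewrite inE LC.
have LB i j : i \in R -> j \in ~: C -> L i j \in ~: S.
  by move=> iR; rewrite !inE LR.
have LCC i j : i \in ~: R -> j \in C -> L i j \in ~: S.
  by move=> iR jC; move: iR; rewrite !inE LC.
have splitI (f : 'I_6 -> 'M[F]_6) (X : {set 'I_6}) :
    \sum_i f i = \sum_(i in X) f i + \sum_(i in ~: X) f i.
  by rewrite (bigID (mem X)) /=; congr (_ + _); apply: eq_bigl => i; rewrite inE.
have rowE i : row_sum p C i + row_sum p (~: C) i = 1 by rewrite -splitI.
have colE j : col_sum p R j + col_sum p (~: R) j = 1 by rewrite -splitI.
have symE s : s \in ~: S -> sym_sum L p R (~: C) s + sym_sum L p (~: R) C s = 1.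
  move=> sS; rewrite -(sum_sym s) (splitI _ R); congr (_ + _).
    apply: eq_bigr => i iR; apply: eq_bigl => j.
    case: eqP => [Ls|]; rewrite ?andbF //; rewrite inE in sS.
    by rewrite inE -(LR i) // Ls sS.
  apply: eq_bigr => i iR; apply: eq_bigl => j.
  case: eqP => [Ls|]; rewrite ?andbF //; rewrite !inE in iR sS.
  by rewrite -[j \in C]negbK -(LR' i) // Ls sS.
(* In the names below, A, B, C, D are the blocks R x C, R x ~: C, ~: R x C and ~: R x ~: C. Rows
   give A + B = C + D = 3, columns A + C = 3, and the symbols of [S], confined to A and D, A + D =
   3. Hence 2A + 3 = 6. *)
pose blk (R' C' : {set 'I_6}) := \sum_(i in R') row_sum p C' i.
have XR (Y : {set 'I_6}) : #|Y| = 3 -> blk Y C + blk Y (~: C) = 3%:R.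
  move=> Y3; rewrite -big_split /= (eq_bigr _ (fun i _ => rowE i)).
  by rewrite sumr_const Y3.
have XAB := XR _ R3; have XCD := XR _ R'3.
have XAC : blk R C + blk (~: R) C = 3%:R.
  rewrite -splitI exchange_big /=.
  by rewrite (eq_bigr _ (fun j _ => sum_col j)) sumr_const C3.
have symS i :
    \sum_(s in S) \sum_(j | L i j == s) p i j = \sum_(j | L i j \in S) p i j.
  rewrite [RHS](partition_big (L i) (mem S)) //=; apply: eq_bigr => s sS.
  by apply: eq_bigl => j; case: eqP => [->|]; rewrite ?sS ?andbF.
have XAD : blk R C + blk (~: R) (~: C) = 3%:R.
  have <- : \sum_(s in S) (1 : 'M[F]_6) = 3%:R by rewrite sumr_const S3.
  rewrite -(eq_bigr _ (fun s _ => sum_sym s)).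
  rewrite exchange_big (splitI _ R) /=; congr (_ + _); apply: eq_bigr => i iR.
    by rewrite symS; apply: eq_bigl => j; rewrite LR.
  by rewrite symS; apply: eq_bigl => j; rewrite inE in iR; rewrite inE LR'.
have XA : blk R C *+ 2 = 3%:R.
  by apply: (addIr (3%:R : 'M[F]_6)); rewrite -{1}XCD mulr2n addrACA XAC XAD.
have XB : blk R (~: C) *+ 2 = 3%:R.
  by apply: (addrI (blk R C *+ 2)); rewrite -mulrnDl XAB XA mulr2n.
have XC : blk (~: R) C *+ 2 = 3%:R.
  by apply: (addrI (blk R C *+ 2)); rewrite -mulrnDl XAC XA mulr2n.
have /card_gt1P[i [i' [iR i'R ii']]] : (1 < #|R|)%N by rewrite R3.
have /card_gt1P[k [k' [kR k'R kk']]] : (1 < #|~: R|)%N by rewrite R'3.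
have /card_gt0P[j jC] : (0 < #|C|)%N by rewrite C3.
have /card_gt0P[l lC] : (0 < #|~: C|)%N by rewrite C'3.
have /card_gt0P[s sS] : (0 < #|S|)%N by rewrite S3.
have /card_gt0P[t tS] : (0 < #|~: S|)%N by rewrite S'3.
have rel := latin_block_relations L_row L_col p_idem p_row p_col p_sym.
have [K2 [rr cc] [rK cK _] [rc3 _ _]] :=
  rel _ _ _ _ _ _ _ R3 C3 S3 LA XA iR i'R ii' jC sS.
have [_ _ [_ _ tK] [_ rt3 _]] :=
  rel _ _ _ _ _ _ _ R3 C'3 S'3 LB XB iR i'R ii' lC tS.
have [_ _ _ [_ _ ct3]] :=
  rel _ _ _ _ _ _ _ R'3 C3 S'3 LCC XC kR k'R kk' jC tS.
(* The row reflections of the second block are the negatives of those of the first, so both blocks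
   have the same commutator [K], and the symbol reflection anticommutes with it too. *)
move: tK rt3 ct3; rewrite !(refl_of_compl (rowE _)) (refl_of_compl (colE _)).
rewrite (refl_of_compl (symE _ tS)) !mulrNN mulNr.
move: K2 rr cc rK cK rc3; move: (refl_of _) (refl_of _) (refl_of _) (refl_of _).
move=> u c r' r; move: (r * r' - r' * r) => K K2 rr cc rK cK rc3 uK ru3 cu3.
have comm x y : x * K = - (K * x) -> y * K = - (K * y) -> x * y * K = K * (x * y).
  by move=> xK yK; rewrite -mulrA yK mulrN !mulrA xK mulNr opprK.
(* The matrix size is 5 + 1 and the eigenspace has dimension 3. The product of r c and c u is r u,
   whose cube is -1 because (- r u)^3 = 1. *)
have := @no_odd_cube_roots F 5 3 erefl erefl K r K2 rr rK (r * c) (c * u)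
  (comm _ _ rK cK) (comm _ _ cK uK) rc3 cu3.
rewrite mulrA -(mulrA r) cc mulr1 => /eqP[].
by rewrite -[LHS]opprK -ru3 exprNn -signr_odd /= expr1 mulN1r.
Qed.

End ProjectionSquare.

(** * From quantum Latin squares to rank-one projections *)

Section RankOne.
Variables (C : numClosedFieldType) (n : nat).
Implicit Types (u v : 'I_n -> C) (f : 'I_n -> 'I_n -> C).

Definition rank1_proj u : 'M[C]_n := \matrix_(s, t) (u s * (u t)^*).

Lemma mul_rank1_proj u v :
  rank1_proj u *m rank1_proj v = hdot u v *: \matrix_(s, t) (u s * (v t)^*).
Proof.
apply/matrixP => s t; rewrite !mxE /hdot mulr_suml; apply: eq_bigr => k _.
by rewrite !mxE -!mulrA mulrCA [u s * (_ * _)]mulrCA.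
Qed.

(** Orthonormality reads U V = 1 for square matrices; the reversed product V U = 1 is the resolution
    of the identity. *)
Lemma sum_rank1_proj f :
  (forall a b, hdot (f a) (f b) = (a == b)%:R) -> \sum_a rank1_proj (f a) = 1%:M.
Proof.
move=> f_orth; pose U := \matrix_(a, t) (f a t)^*; pose V := \matrix_(t, b) f b t.
have UV : U *m V = 1%:M.
  apply/matrixP => a b; rewrite !mxE -f_orth /hdot.
  by apply: eq_bigr => t _; rewrite !mxE.
rewrite -(mulmx1C UV); apply/matrixP => s t; rewrite summxE !mxE.
by apply: eq_bigr => a _; rewrite !mxE.
Qed.

End RankOne.

Lemma hdot_tensor (C : numClosedFieldType) (S T : finType)
    (u u' : S -> C) (v v' : T -> C) :
  hdot (tensor u v) (tensor u' v') = hdot u u' * hdot v v'.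
Proof.
rewrite /hdot mulr_suml; under [RHS]eq_bigr do rewrite mulr_sumr.
rewrite pair_bigA; apply: eq_bigr => -[s t] _ /=.
by rewrite /tensor /= rmorphM mulrACA.
Qed.

(** Both vectors are nonzero multiples of one basis vector. In cells with equal symbols,
    orthogonality of the tensors must therefore come from the factors [phi]. *)
Lemma classical_hdot_neq0 (C : numClosedFieldType) (n : nat)
    (psi : 'I_n -> 'I_n -> 'I_n -> C) (L : 'I_n -> 'I_n -> 'I_n) e i j i' j' :
  is_QLS psi -> classical_with psi L e -> L i j = L i' j' ->
  hdot (psi i j) (psi i' j') != 0.
Proof.
move=> [psi_row _] [[e_orth _] psiE] LL.
have coef i0 j0 : exists2 c : C, c != 0 & forall t, psi i0 j0 t = c * e (L i0 j0) t.
  have [c cE] := psiE i0 j0; exists c => //; apply/eqP => c0.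
  have [/(_ j0 j0)] := psi_row i0; rewrite eqxx /hdot big1 => [/eqP|t _].
    by rewrite eq_sym oner_eq0.
  by rewrite !cE c0 !mul0r mulr0.
have [c c0 cE] := coef i j; have [d d0 dE] := coef i' j'.
have -> : hdot (psi i j) (psi i' j') = c^* * d * hdot (e (L i j)) (e (L i j)).
  rewrite /hdot mulr_sumr; apply: eq_bigr => t _.
  by rewrite cE dE -LL rmorphM mulrACA.
by rewrite e_orth eqxx mulr1 mulf_neq0 // conjC_eq0.
Qed.

Lemma card_preim1_inj (I S : finType) (f : I -> S) :
  (forall s, #|[set j | f j == s]| = 1%N) -> injective f.
Proof.
move=> f1 j k fjk; have /eqP/cards1P[x xE] := f1 (f k).
have : j \in [set x] by rewrite -xE inE fjk.
have : k \in [set x] by rewrite -xE inE.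
by rewrite !inE => /eqP -> /eqP ->.
Qed.

Theorem mainTheorem15 (R : realType) :
  ~ exists (psi phi : 'I_6 -> 'I_6 -> 'I_6 -> R[i])
           (L : 'I_6 -> 'I_6 -> 'I_6) (e : 'I_6 -> 'I_6 -> R[i]),
      is_QLS psi /\ is_QLS phi /\ orthogonal_QLS psi phi /\
      is_latin L /\ classical_with psi L e /\ has_subsquare3 L.
Proof.
move=> [psi [phi [L [e [psiQ [[phi_row phi_col] [[orth _] [[Lr Lc] [cl]]]]]]]]].
have L_row i : injective (L i) by apply: card_preim1_inj => s; apply: Lr.
have L_col j : injective (L^~ j) by apply: card_preim1_inj => s; apply: Lc.
have rowE i := (phi_row i).1; have colE j := (phi_col j).1.
have symE i i' j j' : i != i' -> L i j = L i' j' -> hdot (phi i j) (phi i' j') = 0.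
  move=> ii' LL; have := orth (i, j) (i', j').
  rewrite hdot_tensor xpair_eqE (negPf ii').
  by move/eqP; rewrite mulf_eq0 (negPf (classical_hdot_neq0 psiQ cl LL)) => /eqP.
pose p i j := rank1_proj (phi i j).
have p_orth i i' j j' : hdot (phi i j) (phi i' j') = 0 -> p i j * p i' j' = 0.
  by move=> h; rewrite [LHS]mul_rank1_proj h scale0r.
apply: (@no_projection_square _ L p) => //.
- by move=> i j; rewrite [LHS]mul_rank1_proj rowE eqxx scale1r.
- by move=> i j j' jj'; apply: p_orth; rewrite rowE (negPf jj').
- by move=> i i' j ii'; apply: p_orth; rewrite (colE j) (negPf ii').
- by move=> i i' j j' ii' LL; apply: p_orth; apply: symE.
- by move=> i; apply: sum_rank1_proj; apply: rowE.
- by move=> j; apply: sum_rank1_proj; apply: (colE j).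
(* The six cells with symbol s, one per row, carry orthonormal vectors of [phi] by [symE], so their
   projections also sum to 1. *)
move=> s; have /fin_all_exists[col colP] i : exists j, L i j = s.
  by have [g _ gK] := injF_bij (L_row i); exists (g s); rewrite gK.
rewrite -[RHS](@sum_rank1_proj _ _ (fun i => phi i (col i))) => [|i i'].
  apply: eq_bigr => i _; apply: big_pred1 => j /=.
  by rewrite -(colP i) (inj_eq (L_row i)).
by have [->|ii'] := eqVneq i i'; [rewrite rowE eqxx | rewrite symE // !colP].
Qed.
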